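(* Let $\{E_\alpha:\alpha\in A\}$ be any family of Banach spaces. Then the product $Y=\prod_{\alpha\in A}E_\alpha$ (with the product topology) is an Asplund locally convex space if and only if each $E_\alpha$ is Asplund.
   Context: All vector spaces are over $\mathbb{R}$ and all topological vector spaces are Hausdorff. A subset of a topological vector space is bounded if it is absorbed by every neighbourhood of $0$. Let $X$ be a locally convex space with continuous dual $X'$ and let $D\subset X$ be a nonempty open convex set. A convex function $f:D\to\mathbb{R}$ is Fréchet differentiable at $x_0\in D$ if there is a continuous linear functional $f'(x_0)\in X'$ such that for every bounded set $B\subset X$ and every $\epsilon>0$ there is $\delta>0$ such that $\sup_{x\in B}\left|\frac{f(x_0+tx)-f(x_0)}{t}-\langle f'(x_0),x\rangle\right|<\epsilon$ whenever $0<|t|<\delta$ (with $\delta$ small enough that $x_0+tx\in D$ for all $x\in B$). A locally convex space $X$ (in particular a Banach space) is Asplund (ASP) if for every nonempty open convex $D\subset X$, every continuous convex function $f:D\to\mathbb{R}$ is Fréchet differentiable at every point of some dense $G_\delta$ subset of $D$. *)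

(* Defs.v *)
From HB Require Import structures.
From mathcomp Require Import all_boot all_order all_algebra.
From mathcomp Require Import all_classical all_reals all_analysis.
From mathcomp Require Import borel_hierarchy.

Set Implicit Arguments.
Unset Strict Implicit.
Unset Printing Implicit Defensive.

Import Order.TTheory GRing.Theory Num.Theory.
Import numFieldNormedType.Exports.

Local Open Scope classical_set_scope.
Local Open Scope ring_scope.

(* The library equips [prod_topology E] with the product topology (and
   uniformity), but only the non-dependent product with a vector space
   structure.  Addition, opposite and scaling are componentwise. *)
Section product_lmodule.
Context {R : numDomainType} {A : Type} (E : A -> tvsType R).
Let Y := prod_topology E.
Implicit Types (f g h : Y) (k : R).

Let add f g : Y := fun a => f a + g a.
Let opp f : Y := fun a => - f a.
Let zero : Y := fun=> 0.
Let scale k f : Y := fun a => k *: f a.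

Let addA : associative add.
Proof. by move=> f g h; apply: functional_extensionality_dep => a; exact: addrA. Qed.

Let addC : commutative add.
Proof. by move=> f g; apply: functional_extensionality_dep => a; exact: addrC. Qed.

Let add0 : left_id zero add.
Proof. by move=> f; apply: functional_extensionality_dep => a; exact: add0r. Qed.

Let addN : left_inverse zero opp add.
Proof. by move=> f; apply: functional_extensionality_dep => a; exact: addNr. Qed.

HB.instance Definition _ := GRing.isZmodule.Build (prod_topology E) addA addC add0 addN.

Let scaleA k l f : scale k (scale l f) = scale (k * l) f.
Proof. by apply: functional_extensionality_dep => a; exact: scalerA. Qed.

Let scale1 : left_id 1 scale.
Proof. by move=> f; apply: functional_extensionality_dep => a; exact: scale1r. Qed.

Let scaleDr : right_distributive scale +%R.
Proof. by move=> k f g; apply: functional_extensionality_dep => a; exact: scalerDr. Qed.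

Let scaleDl f : {morph scale^~ f : k l / k + l}.
Proof. by move=> k l; apply: functional_extensionality_dep => a; exact: scalerDl. Qed.

HB.instance Definition _ :=
  GRing.Zmodule_isLmodule.Build R (prod_topology E) scaleA scale1 scaleDr scaleDl.

End product_lmodule.

Section product_tvs.
Context {R : numFieldType} {A : Type} (E : A -> tvsType R).
Let Y := prod_topology E.

Let cvg_coord (F : set_system Y) (FF : Filter F) (x : Y) :
  F --> x <-> forall a, (fun y : Y => y a) @ F --> x a.
Proof.
split=> [/cvg_sup Fx a V /= nV|Fx].
  apply: (Fx a); exact: (@initial_continuous Y (E a) (fun y => y a) x V nV).
apply/cvg_sup => a W /= [_ [[V oV <-] Vx VW]].
apply: filterS VW _; apply: (Fx a); exact: open_nbhs_nbhs.
Qed.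

Let coord_continuous a : continuous (fun y : Y => y a).
Proof. by move=> x; move: a; apply/(cvg_coord (F := nbhs x)). Qed.

Let add_continuous : continuous (fun x : Y * Y => x.1 + x.2).
Proof.
move=> [x y]; apply/cvg_coord => a.
have h1 : (fun z : Y * Y => z.1 a) @ (x, y) --> x a.
  apply: (@cvg_comp _ _ _ fst (fun y : Y => y a) (nbhs (x, y)) (nbhs x)).
    exact: cvg_fst.
  exact: coord_continuous.
have h2 : (fun z : Y * Y => z.2 a) @ (x, y) --> y a.
  apply: (@cvg_comp _ _ _ snd (fun y : Y => y a) (nbhs (x, y)) (nbhs y)).
    exact: cvg_snd.
  exact: coord_continuous.
exact: (cvg_comp _ _ (cvg_pair h1 h2) (@add_continuous (E a) (x a, y a))).
Qed.

Let scale_continuous : continuous (fun z : R^o * Y => z.1 *: z.2).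
Proof.
move=> [k x]; apply/cvg_coord => a.
have h1 : (fun z : R^o * Y => z.1) @ (k, x) --> (k : R^o) by exact: cvg_fst.
have h2 : (fun z : R^o * Y => z.2 a) @ (k, x) --> x a.
  apply: (@cvg_comp _ _ _ snd (fun y : Y => y a) (nbhs (k, x)) (nbhs x)).
    exact: cvg_snd.
  exact: coord_continuous.
exact: (cvg_comp _ _ (cvg_pair h1 h2) (@scale_continuous R (E a) (k, x a))).
Qed.

Let locally_convex : exists2 B : set_system Y,
  (forall b, b \in B -> convex_set b) & basis B.
Proof.
exists [set U : set Y | open U /\ convex_set U].
  by move=> U /set_mem[].
split=> [U []//|x].
have FF : Filter (filter_from
    [set U : set Y | (open U /\ convex_set U) /\ U x] id).
  apply: filter_from_filter.
    exists setT; split=> //; split; first exact: openT.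
    by move=> *; rewrite inE.
  move=> U V [[oU cU] Ux] [[oV cV] Vx]; exists (U `&` V) => //.
  split=> //; split; first exact: openI.
  move=> y z k; rewrite !in_setI => /andP[yU yV] /andP[zU zV].
  by rewrite cU// cV.
apply/cvg_coord => a W Wx.
have [B cB [oB /(_ (x a) W Wx)[V [BV Vx] VW]]] := @locally_convex R (E a).
exists ((fun y : Y => y a) @^-1` V); last by move=> y /VW.
split=> //; split.
  by apply: open_comp (oB _ BV) => y _; exact: coord_continuous.
move=> y z k; rewrite !inE => Vy Vz.
by apply/set_mem/(cB _ (mem_set BV)); exact/mem_set.
Qed.

HB.instance Definition _ :=
  PreTopologicalNmodule_isTopologicalNmodule.Build (prod_topology E) add_continuous.
HB.instance Definition _ :=
  TopologicalNmodule_isTopologicalLmodule.Build R (prod_topology E) scale_continuous.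
HB.instance Definition _ := Uniform_isTvs.Build R (prod_topology E) locally_convex.

End product_tvs.

Section asplund.
Context {R : realType}.

Definition absorbs (X : tvsType R) (U B : set X) :=
  exists2 r : R, 0 < r & forall t : R, r <= `|t| -> B `<=` [set t *: u | u in U].

(* Not [bounded_set], which refers to a norm. *)
Definition tvs_bounded (X : tvsType R) (B : set X) :=
  forall U : set X, nbhs 0 U -> absorbs U B.

(* [f] is total, but only its values on [D] matter.  The supremum is taken in
   the extended reals: a real-valued [sup] would be 0 on unbounded sets. *)
Definition frechet_differentiable (X : tvsType R) (D : set X) (f : X -> R^o)
    (x0 : X) :=
  exists2 l : {linear X -> R^o}, continuous l &
  forall B : set X, tvs_bounded B -> forall eps : R, 0 < eps ->
  exists2 delta : R, 0 < delta & forall t : R, 0 < `|t| < delta ->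
    (forall x, B x -> D (x0 + t *: x)) /\
    (ereal_sup [set (`|(f (x0 + t *: x) - f x0) / t - l x|)%:E | x in B]
       < eps%:E)%E.

(* [tvsType] does not include the Hausdorff axiom.
   As [D] is open, the subsets of [D] that are G_delta in [D] are exactly those
   that are G_delta in [X]. *)
Definition asplund (X : tvsType R) :=
  hausdorff_space X /\
  forall (D : set X) (f : X -> R^o),
    D !=set0 -> open D -> convex_set D ->
    {within D, continuous f} -> convex_function D f ->
    exists G : set X, [/\ G `<=` D, Gdelta G, D `<=` closure G &
      forall x, G x -> frechet_differentiable D f x].

End asplund.

(* Main.v *)
(* A continuous convex function f is Frechet differentiable at x iff the second
   differences f(x + d h) + f(x - d h) - 2 f(x) are at most e d for some d > 0,
   uniformly over h in the relevant bounded set, for every e > 0.  For fixed e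
   this is an open condition on x, so in a Banach space the set of points of
   Frechet differentiability of f is G_delta; composing with a coordinate
   projection then shows that each factor of an Asplund product is Asplund.

   Conversely, f is bounded above near some point of D in Y, hence locally
   Lipschitz at every point of D for the seminorm p(y) = sum_(a in F) |y a|
   with F finite.  For a in F, the points where f satisfies the e-condition
   along the unit ball of E_a form an open set, dense because every slice of D
   parallel to the Asplund space E_a meets it.  By a Baire argument for p,
   densely many points satisfy all these conditions; and for convex f smoothness
   in two sets of directions gives smoothness in their sum, by midpoint
   convexity: f(x + h + k) <= (f(x + 2h) + f(x + 2k)) / 2. *)

Require Import Defs.
From HB Require Import structures.
From mathcomp Require Import all_boot all_order all_algebra.
From mathcomp Require Import all_classical all_reals all_analysis.
From mathcomp Require Import ring lra.

Set Implicit Arguments.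
Unset Strict Implicit.
Unset Printing Implicit Defensive.

Import Order.TTheory GRing.Theory Num.Theory.
Import numFieldNormedType.Exports.

Local Open Scope classical_set_scope.
Local Open Scope ring_scope.

(** * Convexity, Lipschitz bounds and second differences for a seminorm *)

Section convex_lmodule.
Context {R : realType} {X : lmodType R}.
Implicit Types (D H : set X) (f p : X -> R) (x y h u v w : X) (a b c d r s t M L : R).

Definition convex_fun_on D f := forall x y s, D x -> D y -> 0 <= s <= 1 ->
  D (s *: x + (1 - s) *: y) /\
  f (s *: x + (1 - s) *: y) <= s * f x + (1 - s) * f y.

Definition seminorm p :=
  (forall x y, p (x + y) <= p x + p y) /\ (forall k x, p (k *: x) = `|k| * p x).

Definition bounded_near p D f x :=
  exists r M, 0 < r /\ forall y, p (y - x) < r -> D y /\ f y <= M.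

(** The bound uses a positive [d] above [p (u - v)], because [p] may vanish at [u - v] while the
    proof of the bound divides by [d]. *)
Definition lipschitz_near p D f x := exists r L, [/\ 0 < r, 0 < L &
  forall u v d, 0 < d -> p (u - v) <= d -> p (u - x) < r -> p (v - x) < r ->
    [/\ D u, D v & f u - f v <= L * d]].

(** One pair [d], [c] serves all of [H], which gives the uniformity in Frechet differentiability;
    the gap between [c] and [eps] makes the condition survive small moves of [x]. *)
Definition eps_smooth D f H eps x := exists d c, [/\ 0 < d, c < eps &
  forall h, H h -> [/\ D (x + d *: h), D (x + - d *: h) &
    f (x + d *: h) + f (x + - d *: h) - 2 * f x <= c * d]].

Lemma combo_shift s x u v :
  s *: (x + u) + (1 - s) *: (x + v) = x + (s *: u + (1 - s) *: v).
Proof. by rewrite !scalerDr addrACA -scalerDl subrKC scale1r. Qed.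

Lemma seminorm0 p : seminorm p -> p 0 = 0.
Proof. by case=> _ pZ; rewrite -(scale0r 0) pZ normr0 mul0r. Qed.

Lemma seminormN p x : seminorm p -> p (- x) = p x.
Proof. by case=> _ pZ; rewrite -scaleN1r pZ normrN1 mul1r. Qed.

Lemma seminorm_ge0 p x : seminorm p -> 0 <= p x.
Proof.
move=> sp; have := sp.1 x (- x).
by rewrite subrr seminorm0// seminormN// -mulr2n pmulrn_lge0.
Qed.

Lemma seminormBC p x y : seminorm p -> p (x - y) = p (y - x).
Proof. by move=> sp; rewrite -opprB seminormN. Qed.

Lemma seminorm_dist p x y z : seminorm p -> p (x - z) <= p (x - y) + p (y - z).
Proof. by move=> sp; rewrite -[x - z](subrKA y); exact: sp.1. Qed.

Lemma convex_chord D f x h a b t : convex_fun_on D f ->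
  a < b -> a <= t <= b -> D (x + a *: h) -> D (x + b *: h) ->
  D (x + t *: h) /\
  (b - a) * f (x + t *: h) <=
    (b - t) * f (x + a *: h) + (t - a) * f (x + b *: h).
Proof.
move=> cf ab /andP[a_t t_b] Da Db.
have ba : 0 < b - a by rewrite subr_gt0.
have s01 : 0 <= (b - t) / (b - a) <= 1.
  by rewrite ler_pdivrMr// mul1r lerD2l lerN2 a_t andbT divr_ge0// subr_ge0// ltW.
have := cf _ _ _ Da Db s01; rewrite combo_shift !scalerA -scalerDl.
have -> : (b - t) / (b - a) * a + (1 - (b - t) / (b - a)) * b = t.
  by field; rewrite gt_eqF.
move=> [Dt ft]; split=> //.
move: ft; rewrite -(ler_pM2l ba) => /le_trans; apply.
rewrite le_eqVlt; apply/orP; left; apply/eqP; field.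
by rewrite gt_eqF.
Qed.

Lemma convex_midpoint D f x h k : convex_fun_on D f ->
  D (x + 2 *: h) -> D (x + 2 *: k) ->
  D (x + (h + k)) /\ 2 * f (x + (h + k)) <= f (x + 2 *: h) + f (x + 2 *: k).
Proof.
move=> cf Dh Dk; have := cf _ _ 2^-1 Dh Dk; rewrite combo_shift.
have -> : 1 - 2^-1 = 2^-1 :> R by rewrite {1}[1]splitr div1r addrK.
rewrite !scalerA mulVf// !scale1r => -[|Dhk fhk].
  by rewrite invr_ge0 invf_le1//; lra.
by split=> //; lra.
Qed.

(** The point [y] lies between [x] and a point [z] of [D] beyond it: [y = l z + (1 - l) x].
    Contracting the ball at [x] towards [z] by the factor [1 - l] gives a ball at [y], on which
    convexity bounds [f]. *)
Lemma bounded_near_spread p D f x y : seminorm p -> convex_fun_on D f ->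
  (forall v, exists2 s, 0 < s & D (y + s *: v)) ->
  bounded_near p D f x -> bounded_near p D f y.
Proof.
move=> [_ pZ] cf aD [r [M [r0 xr]]].
have [s s0 Dz] := aD (y - x); set z := y + _ in Dz.
have s10 : 0 < 1 + s by lra.
set l := (1 + s)^-1.
have l01 : 0 <= l <= 1.
  by rewrite invr_ge0 ltW//= invf_le1//; lra.
have l1 : 0 < 1 - l by rewrite subr_gt0 invf_lt1//; lra.
exists (r * (1 - l)), (l * f z + (1 - l) * M); split; first by rewrite mulr_gt0.
move=> v vr; set w := x + (1 - l)^-1 *: (v - y).
have [Dw fw] : D w /\ f w <= M.
  apply: xr; rewrite /w addrC addKr pZ gtr0_norm ?invr_gt0//.
  by rewrite mulrC ltr_pdivrMr.
have -> : v = l *: z + (1 - l) *: w.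
  rewrite /z /w.
  have -> : x + (1 - l)^-1 *: (v - y) = y + (x - y + (1 - l)^-1 *: (v - y)).
    by rewrite addrA subrKC.
  rewrite combo_shift [(1 - l) *: _]scalerDr !scalerA divff ?gt_eqF// scale1r.
  rewrite -(opprB y x) scalerN [(l * s) *: _ + _]addrA -scalerBl.
  have -> : l * s - (1 - l) = 0.
    by rewrite /l; field; rewrite gt_eqF.
  by rewrite scale0r add0r subrKC.
have [Dv fv] := cf _ _ _ Dz Dw l01; split=> //.
by apply: le_trans fv _; rewrite lerD2l ler_wpM2l// ltW.
Qed.

(** Reflection in [x] turns the upper bound into a lower one. Prolonging the segment from [v] to [u]
    beyond [u] to a point [w] at distance at most [r / 2] then bounds the slope by convexity. *)
Lemma bounded_near_lipschitz p D f x : seminorm p -> convex_fun_on D f ->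
  bounded_near p D f x -> lipschitz_near p D f x.
Proof.
move=> sp cf [r [M [r0 xr]]].
have [Dx fxM] : D x /\ f x <= M by apply: xr; rewrite subrr seminorm0.
have lb y : p (y - x) < r -> 2 * f x - M <= f y.
  move=> yr.
  have [Dy _] := xr _ yr.
  have [|Dy' fy'] := xr (x - (y - x)).
    by rewrite addrC addKr seminormN.
  have := @convex_midpoint D f x (2^-1 *: (y - x)) (2^-1 *: - (y - x)) cf.
  rewrite !scalerA divff// !scale1r subrKC scalerN subrr addr0.
  by move=> /(_ Dy Dy')[_]; lra.
have r2 : 0 < r / 2 by lra.
(* The oscillation is at most [M - (2 * f x - M)], that is [2 * (M - f x)]; the [+ 1] keeps the
   constant positive when [f x = M]. *)
exists (r / 2), (2 * (M - f x + 1) / (r / 2)); split => //.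
  by rewrite divr_gt0// mulr_gt0//; lra.
move=> u v d d0 uvd ur vr.
have hr y : p (y - x) < r / 2 -> p (y - x) < r by lra.
have [Du fu] := xr _ (hr _ ur); have [Dv fv] := xr _ (hr _ vr); split=> //.
have K0 : 0 < d / (r / 2) by rewrite divr_gt0.
set w := u + (r / 2 / d) *: (u - v).
have [Dw fw] : D w /\ f w <= M.
  apply: xr; apply: le_lt_trans (seminorm_dist _ u _ sp) _.
  rewrite /w [u + _ *: _]addrC addrK sp.2 gtr0_norm ?divr_gt0//.
  have : r / 2 / d * p (u - v) <= r / 2.
    by rewrite mulrAC ler_pdivrMr// ler_pM2l.
  lra.
have dr : 0 < d + r / 2 by lra.
have s01 : 0 <= d / (d + r / 2) <= 1.
  by rewrite ler_pdivrMr// mul1r divr_ge0//=; lra.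
have [_] := cf _ _ _ Dw Dv s01.
have -> : d / (d + r / 2) *: w + (1 - d / (d + r / 2)) *: v = u.
  rewrite /w -{2}(subrKC u v) combo_shift -(opprB u v) scalerN scalerA -scalerBl.
  have -> : d / (d + r / 2) * (r / 2 / d) - (1 - d / (d + r / 2)) = 0.
    by field; rewrite !gt_eqF//; lra.
  by rewrite scale0r addr0.
have lv := lb _ (hr _ vr).
move=> fuv.
have fuv' : f u - f v <= d / (d + r / 2) * (f w - f v) by lra.
apply: le_trans fuv' _.
have -> : 2 * (M - f x + 1) / (r / 2) * d = d / (r / 2) * (2 * (M - f x + 1)).
  by field; rewrite gt_eqF.
have q0 : 0 <= d / (d + r / 2) by case/andP: s01.
apply: (@le_trans _ _ (d / (d + r / 2) * (2 * (M - f x + 1)))).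
  by apply: ler_wpM2l => //; lra.
apply: ler_wpM2r; first lra.
by apply: ler_wpM2l; [lra|rewrite lef_pV2 ?posrE//; lra].
Qed.

Lemma eps_smooth_le D f H e e' x : e <= e' ->
  eps_smooth D f H e x -> eps_smooth D f H e' x.
Proof.
by move=> ee' [d [c [d0 ce Hh]]]; exists d, c; split=> //; exact: lt_le_trans ee'.
Qed.

(* By convexity the second difference quotient is nondecreasing in the step. *)
Lemma second_diff_shrink D f x h d c t : convex_fun_on D f -> D x ->
  D (x + d *: h) -> D (x + - d *: h) ->
  f (x + d *: h) + f (x + - d *: h) - 2 * f x <= c * d ->
  0 < t <= d ->
  [/\ D (x + t *: h), D (x + - t *: h) &
    f (x + t *: h) + f (x + - t *: h) - 2 * f x <= c * t].
Proof.
move=> cf Dx Dp Dm fd /andP[t0 td].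
have d0 : 0 < d by exact: lt_le_trans td.
have Dx0 : D (x + 0 *: h) by rewrite scale0r addr0.
have [Dp' fp] := @convex_chord D f x h 0 d t cf d0 (ltac:(lra)) Dx0 Dp.
have [Dm' fm] :=
  @convex_chord D f x h (- d) 0 (- t) cf (ltac:(lra)) (ltac:(lra)) Dm Dx0.
split=> //; rewrite -(ler_pM2l d0).
rewrite scale0r addr0 in fp fm.
have : t * (f (x + d *: h) + f (x + - d *: h) - 2 * f x) <= t * (c * d).
  by rewrite ler_pM2l.
lra.
Qed.

Lemma eps_smooth_shrink D f H e x t : convex_fun_on D f -> D x -> 0 < t ->
  eps_smooth D f H e x ->
  exists d c, [/\ 0 < d <= t, c < e &
    forall s h, 0 < s <= d -> H h -> [/\ D (x + s *: h), D (x + - s *: h) &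
      f (x + s *: h) + f (x + - s *: h) - 2 * f x <= c * s]].
Proof.
move=> cf Dx t0 [d [c [d0 ce Hd]]]; exists (Num.min d t), c; split=> //.
  by rewrite lt_min d0 t0 ge_min lexx orbT.
move=> s h /andP[s0 sd] /Hd[Dp Dm fd].
apply: second_diff_shrink Dp Dm fd _ => //.
by rewrite s0 (le_trans sd)// ge_min lexx.
Qed.

Lemma eps_smooth_open p D f H e x K : seminorm p -> convex_fun_on D f ->
  bounded_near p D f x -> 0 < K -> (forall h, H h -> p h <= K) ->
  eps_smooth D f H e x ->
  exists2 r, 0 < r & forall y, p (y - x) < r -> D y /\ eps_smooth D f H e y.
Proof.
move=> sp cf bx K0 HK sx.
have [r [L [r0 L0 lip]]] := bounded_near_lipschitz sp cf bx.
have r2K : 0 < r / (2 * K) by rewrite divr_gt0// mulr_gt0.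
have Dx : D x by case: (lip x x 1) => //; rewrite subrr seminorm0.
have [d [c [/andP[d0 dr] ce Hd]]] := eps_smooth_shrink cf Dx r2K sx.
have dK h : H h -> forall t, `|t| <= d -> p (t *: h) <= r / 2.
  move=> /HK hK t td; rewrite sp.2.
  apply: (@le_trans _ _ (d * K)); first by rewrite ler_pM// seminorm_ge0.
  have -> : r / 2 = r / (2 * K) * K by field; rewrite gt_eqF.
  by rewrite ler_wpM2r// ltW.
(* Moving the centre by less than [eta] raises the second difference by at most [4 * L * eta], hence
   by at most half of the gap [(e - c) * d]. *)
pose eta := Num.min (r / 2) ((e - c) * d / (8 * L)).
have eta0 : 0 < eta.
  by rewrite lt_min divr_gt0//= divr_gt0 ?mulr_gt0// subr_gt0.
exists eta => // y yx.
have yxr : p (y - x) < r / 2 by move: yx; rewrite lt_min => /andP[].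
split.
  by case: (lip y x eta) => //; rewrite ?ltW// ?subrr ?seminorm0//; lra.
have etaL : L * eta <= (e - c) * d / 8.
  have -> : (e - c) * d / 8 = L * ((e - c) * d / (8 * L)) by field; rewrite gt_eqF.
  by rewrite ler_pM2l// ge_min lexx orbT.
exists d, ((c + e) / 2); split=> //; first lra.
move=> h Hh; have [|_ _ fd] := Hd d h _ Hh; first by rewrite d0/=.
have near t : `|t| <= d ->
    D (y + t *: h) /\ f (y + t *: h) - f (x + t *: h) <= L * eta.
  move=> td; have th := dK _ Hh _ td.
  have [|||? _ ?] := lip (y + t *: h) (x + t *: h) eta eta0 => //.
  - by rewrite opprD addrACA subrr addr0 ltW.
  - rewrite addrAC; apply: le_lt_trans (sp.1 _ _) _; lra.
  - rewrite [x + _]addrC addrK; lra.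
have [|Dp fp] := near d; first by rewrite gtr0_norm.
have [|Dm fm] := near (- d); first by rewrite normrN gtr0_norm.
have [|||_ _ fx] := lip x y eta eta0; first by rewrite seminormBC// ltW.
- by rewrite subrr seminorm0.
- lra.
split=> //; lra.
Qed.

Lemma eps_smoothZ D f H k x : 0 < k ->
  (forall e, 0 < e -> eps_smooth D f H e x) ->
  forall e, 0 < e -> eps_smooth D f [set k *: h | h in H] e x.
Proof.
move=> k0 Hs e e0; have [|d [c [d0 ce Hd]]] := Hs (e / k); first by rewrite divr_gt0.
exists (d / k), (c * k); split; rewrite ?divr_gt0// -?ltr_pdivlMr//.
move=> _ [h /Hd[Dp Dm fd] <-]; rewrite !scalerA mulNr divfK ?gt_eqF//; split=> //.
by have -> : c * k * (d / k) = c * d by field; rewrite gt_eqF.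
Qed.

Lemma eps_smoothD D f H K x : convex_fun_on D f -> D x ->
  (forall e, 0 < e -> eps_smooth D f H e x) ->
  (forall e, 0 < e -> eps_smooth D f K e x) ->
  forall e, 0 < e -> eps_smooth D f [set hk.1 + hk.2 | hk in H `*` K] e x.
Proof.
move=> cf Dx sH sK e e0; have e2 : 0 < e / 2 by rewrite divr_gt0.
have [d1 [c1 [/andP[d10 _] ce1 H1]]] := eps_smooth_shrink cf Dx ltr01 (sH _ e2).
have [d2 [c2 [/andP[d20 d21] ce2 H2]]] := eps_smooth_shrink cf Dx d10 (sK _ e2).
have h2 : 0 < d2 / 2 by rewrite divr_gt0.
(* Since [d2 <= d1], both estimates hold at step [d2]. Midpoint convexity halves the step, and the
   mean of the two bounds [c1 * d2] and [c2 * d2] is [c1 + c2] times the new step. *)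
exists (d2 / 2), (c1 + c2); split => //; first lra.
move=> _ [[h k] /=[Hh Kk] <-].
have [|Dp1 Dm1 f1] := H1 d2 h _ Hh; first by rewrite d20.
have [|Dp2 Dm2 f2] := H2 d2 k _ Kk; first by rewrite d20 lexx.
have E t w : 2 *: (t / 2 *: w) = t *: w by rewrite scalerA mulrC divfK.
have := @convex_midpoint D f x (d2 / 2 *: h) (d2 / 2 *: k) cf.
rewrite !E => /(_ Dp1 Dp2)[].
have := @convex_midpoint D f x (- d2 / 2 *: h) (- d2 / 2 *: k) cf.
rewrite !E => /(_ Dm1 Dm2)[].
rewrite -!scalerDr !mulNr => Dm fm Dp fp; split=> //; lra.
Qed.

End convex_lmodule.

(** * Derivatives of a convex function along lines *)

Section line_derivative.
Context {R : realType} {X : lmodType R}.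
Implicit Types (D H : set X) (f p : X -> R) (x y h k u v w : X) (a b c d r s t M L : R).

Definition line_derivative f x h a := forall e, 0 < e ->
  exists2 d, 0 < d &
    forall t, `|t| <= d -> `|f (x + t *: h) - f x - t * a| <= e * `|t|.

(** A subgradient at 0 of the restriction of [f] to the line, tested at symmetric pairs of
    points. *)
Definition line_subgradient D f x h a := forall t, 0 < t ->
  D (x + t *: h) -> D (x + - t *: h) ->
  f x - f (x + - t *: h) <= t * a <= f (x + t *: h) - f x.

(** The infimum of the right difference quotients works: convexity at [- s < 0 < t] makes every left
    quotient a lower bound. Smoothness supplies a point of [D] ahead of [x], so that the infimum is
    over a nonempty set. *)
Lemma line_subgradient_exists D f x h : convex_fun_on D f -> D x ->
  eps_smooth D f [set h] 1 x -> exists a, line_subgradient D f x h a.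
Proof.
move=> cf Dx [d [c [d0 _ /(_ h erefl)[Dp Dm _]]]].
pose S := [set q | exists t,
  [/\ 0 < t, D (x + t *: h) & q = (f (x + t *: h) - f x) / t]].
have lbS s : 0 < s -> D (x + - s *: h) -> lbound S ((f x - f (x + - s *: h)) / s).
  move=> s0 Ds _ [t [t0 Dt ->]].
  have [] := @convex_chord _ _ D f x h (- s) t 0 cf _ _ Ds Dt; try lra.
  rewrite scale0r addr0 => _ ft.
  rewrite ler_pdivrMr// mulrAC ler_pdivlMr//; lra.
have S0 : S !=set0 by exists ((f (x + d *: h) - f x) / d), d.
exists (inf S) => t t0 Dtp Dtm; apply/andP; split.
  by rewrite mulrC -ler_pdivrMr//; apply: lb_le_inf => //; exact: lbS.
rewrite mulrC -ler_pdivlMr//; apply: ge_inf; last by exists t.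
by exists ((f x - f (x + - t *: h)) / t); exact: lbS.
Qed.

(** One subgradient inequality makes the first-order error nonnegative; the other bounds it above by
    the second difference. *)
Lemma line_subgradient_bound D f x h a c t : line_subgradient D f x h a ->
  D (x + `|t| *: h) -> D (x + - `|t| *: h) ->
  f (x + `|t| *: h) + f (x + - `|t| *: h) - 2 * f x <= c * `|t| ->
  `|f (x + t *: h) - f x - t * a| <= c * `|t|.
Proof.
move=> fa; have [t0|t0|->] := ltrgt0P t.
- by move=> Dp Dm fc; have := fa _ t0 Dp Dm; rewrite ler_norml; lra.
- rewrite opprK => Dp Dm fc; have := fa (- t); rewrite opprK oppr_gt0.
  by move=> /(_ t0 Dp Dm); rewrite ler_norml; lra.
- by rewrite scale0r addr0 subrr sub0r mul0r oppr0 normr0 mulr0.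
Qed.

Lemma line_derivativeP D f x h a : convex_fun_on D f -> D x ->
  (forall e, 0 < e -> eps_smooth D f [set h] e x) ->
  line_subgradient D f x h a -> line_derivative f x h a.
Proof.
move=> cf Dx sx fa e e0.
have [d [c [/andP[d0 _] ce Hd]]] := eps_smooth_shrink cf Dx ltr01 (sx _ e0).
exists d => // t td; have [->|tn0] := eqVneq t 0.
  by rewrite scale0r addr0 subrr sub0r mul0r oppr0 normr0 mulr0.
have t0 : 0 < `|t| by rewrite normr_gt0.
have [|Dp Dm ft] := Hd `|t| h _ erefl; first by rewrite t0.
apply: (le_trans (line_subgradient_bound fa Dp Dm ft)).
by rewrite ler_pM2r// ltW.
Qed.

Lemma line_derivativeZ f x h a (k : R) : line_derivative f x h a ->
  line_derivative f x (k *: h) (k * a).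
Proof.
(* The [+ 1] covers [k = 0]. *)
move=> fa e e0; have k1 : 0 < `|k| + 1 by rewrite ltr_wpDl.
have [|d d0 Hd] := fa (e / (`|k| + 1)); first by rewrite divr_gt0.
exists (d / (`|k| + 1)); first by rewrite divr_gt0.
move=> t td; rewrite scalerA mulrA; apply: le_trans (Hd _ _) _.
  move: td; rewrite ler_pdivlMr// normrM => td; apply: le_trans _ td.
  by rewrite ler_wpM2l// lerDl.
rewrite normrM mulrAC ler_pdivrMr// -mulrA; apply: ler_wpM2l; first exact: ltW.
by rewrite ler_wpM2l// lerDl.
Qed.

Lemma line_derivative_unique f x h a b : line_derivative f x h a ->
  line_derivative f x h b -> a = b.
Proof.
move=> fa fb; apply/eqP; rewrite -subr_eq0 -normr_le0; apply/ler_addgt0Pl => e e0.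
have e2 : 0 < e / 2 by rewrite divr_gt0.
have [d d0 Hd] := fa _ e2; have [d' d'0 Hd'] := fb _ e2.
pose t := Num.min d d'; have t0 : 0 < t by rewrite lt_min d0.
have := Hd t; have := Hd' t.
rewrite gtr0_norm// !ge_min !lexx orbT => /(_ isT) A /(_ isT) B.
rewrite addr0 -(ler_pM2l t0) -{1}(gtr0_norm t0) -normrM.
move: A B; rewrite !ler_norml; lra.
Qed.

(** Midpoint convexity yields [s * c <= s * (a + b)] up to an error small against [s]. As the
    derivatives are two-sided, this holds for [s] of either sign, which forces equality. *)
Lemma line_derivativeD D f x h k a b c : convex_fun_on D f ->
  (forall v, exists2 d, 0 < d & forall t, `|t| <= d -> D (x + t *: v)) ->
  line_derivative f x h a -> line_derivative f x k b ->
  line_derivative f x (h + k) c -> c = a + b.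
Proof.
move=> cf aD fa fb fc.
apply/eqP; rewrite -subr_eq0 -normr_le0; apply/ler_addgt0Pl => e e0.
have e4 : 0 < e / 8 by rewrite divr_gt0.
have [d1 d10 H1] := fa _ e4; have [d2 d20 H2] := fb _ e4.
have [d3 d30 H3] := fc _ e4.
have [d4 d40 H4] := aD h; have [d5 d50 H5] := aD k.
pose t := Num.min (Num.min d1 d2) (Num.min d3 (Num.min d4 d5)) / 2.
have t0 : 0 < t by rewrite divr_gt0// !lt_min d10 d20 d30 d40.
have ht d : 2 * t <= d -> 0 < d -> forall s, `|s| = t -> `|2 * s| <= d /\ `|s| <= d.
  by move=> td _ s st; rewrite normrM (gtr0_norm (ltr0n R 2)) st; split=> //; lra.
have /andP[t1 t2] : (2 * t <= d1) && (2 * t <= d2).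
  by rewrite mulrC divfK// !ge_min !lexx /= !orbT.
have /and3P[t3 t4 t5] : [&& 2 * t <= d3, 2 * t <= d4 & 2 * t <= d5].
  by rewrite mulrC divfK// !ge_min !lexx /= !orbT.
have key s : `|s| = t -> s * (c - (a + b)) <= e * t.
  move=> st.
  have [Dh _] := ht _ t4 d40 s st; have [Dk _] := ht _ t5 d50 s st.
  have := @convex_midpoint _ _ D f x (s *: h) (s *: k) cf.
  rewrite !scalerA -scalerDr => /(_ (H4 _ Dh) (H5 _ Dk))[_ fm].
  have := H1 _ (ht _ t1 d10 s st).1; have := H2 _ (ht _ t2 d20 s st).1.
  have := H3 _ (ht _ t3 d30 s st).2.
  rewrite normrM (gtr0_norm (ltr0n R 2)) st !ler_norml; lra.
rewrite addr0 -(ler_pM2l t0) -{1}(gtr0_norm t0) -normrM ler_norml.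
have := key t (gtr0_norm t0); have := key (- t); rewrite normrN (gtr0_norm t0).
by move=> /(_ erefl); lra.
Qed.

End line_derivative.

(** * Frechet differentiability through second differences *)

Section frechet.
Context {R : realType} {X : tvsType R}.
Implicit Types (D H B U : set X) (f : X -> R^o) (p : X -> R) (x y h u v : X)
  (e s t : R).

Definition continuous_seminorm p :=
  seminorm p /\ forall e, 0 < e -> nbhs 0 [set y | p y < e].

Lemma seminorm_ball_nbhs p x e : continuous_seminorm p -> 0 < e ->
  nbhs x [set y | p (y - x) < e].
Proof.
move=> [_ np] e0; apply: filterS (nbhsT x (np _ e0)) => _ [y /= ye <-].
by rewrite [x + y]addrC addrK.
Qed.

Lemma convex_fun_onP D f :
  convex_set D -> convex_function D f -> convex_fun_on D f.
Proof.
move=> cD cf x y s Dx Dy s01.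
have := cD x y (Itv01 (andP s01).1 (andP s01).2) (mem_set Dx) (mem_set Dy).
rewrite inE; split=> //.
exact: (cf (Itv01 (andP s01).1 (andP s01).2)) (mem_set Dx) (mem_set Dy).
Qed.

Lemma open_absorbing D x v : open D -> D x ->
  exists2 d : R, 0 < d & forall t, `|t| <= d -> D (x + t *: v).
Proof.
move=> oD Dx.
have ct : {for (0 : R^o), continuous (fun t : R^o => x + t *: v)}.
  have h1 : (fun t : R^o => t *: v) @ (0 : R^o) --> (0 : R^o) *: v.
    have hc : (fun=> v) @ (0 : R^o) --> v by exact: cvg_cst.
    exact: (cvg_comp _ _ (cvg_pair (@cvg_id _ (nbhs (0 : R^o))) hc)
      (@scale_continuous R X (0 : R, v))).
  have h2 : (fun=> x) @ (0 : R^o) --> x by exact: cvg_cst.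
  exact: (cvg_comp _ _ (cvg_pair h2 h1) (@add_continuous X (x, 0 *: v))).
have : nbhs (x + (0 : R^o) *: v) D.
  by rewrite scale0r addr0; exact: open_nbhs_nbhs.
move=> /ct/nbhs_normP[d /= d0 dD].
exists (d / 2); first by rewrite divr_gt0.
move=> t td; apply: dD => /=; rewrite sub0r normrN.
by apply: le_lt_trans td _; rewrite ltr_pdivrMr// ltr_pMr// ltr1n.
Qed.

(** Adding the first-order estimates at steps [d / 2] and [- (d / 2)] cancels the linear term. *)
Lemma frechet_eps_smooth D f H x e : tvs_bounded H ->
  frechet_differentiable D f x -> 0 < e -> eps_smooth D f H e x.
Proof.
move=> bH [l cl fl] e0; have e4 : 0 < e / 4 by rewrite divr_gt0.
have [d d0 Hd] := fl H bH _ e4.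
have d2 : 0 < d / 2 by rewrite divr_gt0.
have bound t : 0 < `|t| < d -> forall h, H h ->
    D (x + t *: h) /\ `|(f (x + t *: h) - f x) / t - l h| < e / 4.
  move=> td h Hh; have [Dt st] := Hd _ td; split; first exact: Dt.
  by rewrite -lte_fin; apply: le_lt_trans st; apply: ereal_sup_ubound; exists h.
exists (d / 2), (e / 2); split=> //; first lra.
move=> h Hh.
have [|Dp fp] := bound (d / 2) _ h Hh; first by rewrite gtr0_norm//; lra.
have [|Dm fm] := bound (- (d / 2)) _ h Hh; first by rewrite normrN gtr0_norm//; lra.
split=> //.
move: fp fm; rewrite !ltr_norml invrN mulrN => /andP[_ fp] /andP[fm _].
have : (f (x + d / 2 *: h) - f x) / (d / 2) +
    (f (x + - (d / 2) *: h) - f x) / (d / 2) <= e / 2.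
  lra.
by rewrite -mulrDl ler_pdivrMr//; lra.
Qed.

(** The derivative is assembled from the subgradients along lines: smoothness makes them two-sided
    derivatives, hence linear in the direction; the local bound on [f] makes the result continuous;
    smoothness over the unit ball of [p] makes the estimate uniform on bounded sets. *)
Lemma eps_smooth_frechet p D f x : open D -> convex_fun_on D f -> D x ->
  continuous_seminorm p -> bounded_near p D f x ->
  (forall e, 0 < e -> eps_smooth D f [set h | p h <= 1] e x) ->
  frechet_differentiable D f x.
Proof.
move=> oD cf Dx [sp np] bx sx.
have sline h e : 0 < e -> eps_smooth D f [set h] e x.
  (* Every [h] is a multiple of a vector of the unit ball; dividing by [p h + 1] allows for
     [p h = 0]. *)
  have ph0 : 0 < p h + 1 by rewrite ltr_wpDl// seminorm_ge0.
  move=> e0; have [d [c [d0 ce Hd]]] := eps_smoothZ ph0 sx e0.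
  exists d, c; split=> // _ ->; apply: Hd; exists ((p h + 1)^-1 *: h) => /=.
    by rewrite sp.2 gtr0_norm ?invr_gt0// mulrC ler_pdivrMr// mul1r lerDl.
  by rewrite scalerA divff ?gt_eqF// scale1r.
have [l lsub] := choice (fun h => line_subgradient_exists cf Dx (sline h 1 ltr01)).
have lder h := line_derivativeP cf Dx (sline h) (lsub h).
have aD v := open_absorbing v oD Dx.
have lD h k : l (h + k) = l h + l k.
  exact: (line_derivativeD cf aD (lder h) (lder k) (lder (h + k))).
have lZ (k : R) h : l (k *: h) = k * l h.
  exact: (line_derivative_unique (lder (k *: h)) (line_derivativeZ k (lder h))).
have lin : linear (l : X -> R^o) by move=> k u v; rewrite lD lZ.
pose lM := GRing.isLinear.Build R X R^o *:%R l lin.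
pose L : {linear X -> R^o} := HB.pack l lM.
exists L.
  have [r [M [r0 xr]]] := bx.
  have fxM : f x <= M by apply: (xr x _).2; rewrite subrr seminorm0.
  have lM' h : p h < r -> `|l h| <= M - f x.
    move=> hr.
    have [|Dp fp] := xr (x + h); first by rewrite [x + h]addrC addrK.
    have [|Dm fm] := xr (x - h); first by rewrite [x - h]addrC addrK seminormN.
    have := lsub h 1 ltr01; rewrite scaleN1r scale1r mul1r => /(_ Dp Dm).
    by rewrite ler_norml; lra.
  have K0 : 0 < M - f x + 1 by lra.
  have lsmall e : 0 < e -> nbhs 0 [set h | `|l h| < e].
    move=> e0; have re0 : 0 < r * (e / (M - f x + 1)) by rewrite mulr_gt0// divr_gt0.
    apply: filterS (np _ re0) => h /= hr.
    have : `|l (((M - f x + 1) / e) *: h)| <= M - f x.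
      apply: lM'; rewrite sp.2 gtr0_norm ?divr_gt0//.
      by rewrite mulrC -ltr_pdivlMr ?divr_gt0// invf_div.
    rewrite lZ normrM gtr0_norm ?divr_gt0// mulrAC ler_pdivrMr//.
    have : 0 <= `|l h| by [].
    nra.
  move=> y U /nbhs_normP[e /= e0 eU].
  apply: filterS (nbhsT y (lsmall _ e0)) => _ [h /= he <-].
  by apply: eU => /=; rewrite lD opprD addNKr normrN.
move=> B bB e e0.
(* The unit ball of [p] absorbs [B], so [B] lies in the ball of radius [r], to which smoothness is
   rescaled. *)
have [r r0 rB] := bB _ (np _ ltr01).
have pB h : B h -> p h < r.
  have := rB r; rewrite (gtr0_norm r0) lexx => /(_ isT) /[apply] -[u /= u1 <-].
  by rewrite sp.2 gtr0_norm// -ltr_pdivlMl// mulVf ?gt_eqF.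
have e2 : 0 < e / 2 by rewrite divr_gt0.
have [d [c [/andP[d0 _] ce Hd]]] :=
  eps_smooth_shrink cf Dx ltr01 (eps_smoothZ r0 sx e2).
exists d => // t /andP[t0 td].
have Bd h : B h -> [/\ D (x + `|t| *: h), D (x + - `|t| *: h) &
      f (x + `|t| *: h) + f (x + - `|t| *: h) - 2 * f x <= c * `|t|].
  move=> Bh; apply: Hd; first by rewrite t0 ltW.
  exists (r^-1 *: h) => /=; last by rewrite scalerA divff ?gt_eqF// scale1r.
  by rewrite sp.2 gtr0_norm ?invr_gt0// mulrC ler_pdivrMr// mul1r ltW// pB.
split.
  move=> h Bh; have [Dp Dm _] := Bd _ Bh.
  by move: Dp Dm; have [_|_|<-] := ltrgt0P t; rewrite ?opprK.
apply: (@le_lt_trans _ _ (e / 2)%:E); last by rewrite lte_fin; lra.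
apply: ge_ereal_sup => _ [h Bh <-]; rewrite lee_fin.
have [Dp Dm fd] := Bd _ Bh.
have := line_subgradient_bound (lsub h) Dp Dm fd.
have tn0 : t != 0 by rewrite -normr_gt0.
have -> : (f (x + t *: h) - f x) / t - L h = (f (x + t *: h) - f x - t * l h) / t.
  by rewrite [RHS]mulrBl (mulrC t) mulfK.
rewrite normrM normfV ler_pdivrMr// => /le_trans; apply.
by rewrite ler_pM2r// ltW.
Qed.

End frechet.

(** * Baire category for a complete seminorm *)

Section baire.
Context {R : realType} {X : lmodType R}.
Implicit Types (D : set X) (p : X -> R) (x y z : X) (e r : R).

(** Since [p] need not separate points, [z] is determined only modulo the kernel of [p]. *)
Definition seminorm_complete p := forall u : nat -> X,
  (forall e, 0 < e -> exists N, forall n, (N <= n)%N -> p (u n - u N) < e) ->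
  exists z, forall e, 0 < e -> exists N, forall n, (N <= n)%N -> p (z - u n) < e.

Lemma baire_seminorm p D (U : nat -> set X) : seminorm p -> seminorm_complete p ->
  (forall n, U n `<=` D) ->
  (forall n x, U n x -> exists2 r, 0 < r & forall y, p (y - x) < r -> U n y) ->
  (forall n x r, D x -> 0 < r -> exists2 y, U n y & p (y - x) < r) ->
  forall x r, D x -> 0 < r -> exists2 y, (\bigcap_n U n) y & p (y - x) < r.
Proof.
move=> sp pc UD Uo Ud x r Dx r0.
pose good (s : X * R) := D s.1 /\ 0 < s.2.
(* A state is a centre with a radius. Halving the radius and moving the centre by less than half of
   it keeps the balls nested; the closed ball lies in [U n], so the limit of the centres does
   too. *)
pose next n (s s' : X * R) := [/\ good s', s'.2 <= s.2 / 2, p (s'.1 - s.1) < s.2 / 2 &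
  forall z, p (z - s'.1) <= s'.2 -> U n z].
(* Goodness is a premise here so that every state has a successor, as [choice] demands. *)
have step (ns : nat * (X * R)) : exists s', good ns.2 -> next ns.1 ns.2 s'.
  case: ns => n [y t]; have [[/= Dy t0]|ng] := pselect (good (y, t)); last by exists (y, t).
  have t2 : 0 < t / 2 by rewrite divr_gt0.
  have [y' Uy' y'y] := Ud n y _ Dy t2; have [q q0 Uq] := Uo n y' Uy'.
  exists (y', Num.min (t / 2) (q / 2)) => _; split => /=.
  - by split => /=; [exact: UD Uy'|rewrite lt_min t2 divr_gt0].
  - by rewrite ge_min lexx.
  - by [].
  - move=> z; rewrite le_min => /andP[_ zq]; apply: Uq.
    by apply: le_lt_trans zq _; rewrite ltr_pdivrMr// ltr_pMr// ltr1n.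
have [F HF] := choice step.
pose fix s n := if n is m.+1 then F (m, s m) else (x, r).
have gs n : good (s n) by elim: n => [//|n /(HF (n, s n))[]].
have ns n : next n (s n) (s n.+1) by exact: (HF (n, s n) (gs n)).
have sle n k : p ((s (n + k)%N).1 - (s n).1) <= (s n).2 - (s (n + k)%N).2.
  elim: k => [|k IH]; first by rewrite addn0 !subrr seminorm0.
  rewrite addnS; have [_ le2 lt2 _] := ns (n + k)%N.
  by apply: le_trans (seminorm_dist _ (s (n + k)%N).1 _ sp) _; lra.
(* Halving beats the linear factor because [n + 2 <= 2 * (n + 1)]; the Archimedean property then
   sends the radii to 0. *)
have sr n : (s n).2 * n.+1%:R <= r.
  elim: n => [|n IH]; first by rewrite mulr1.
  have [[_ pos] le2 _ _] := ns n; have [_ pos'] := gs n.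
  have n0 : 0 <= n%:R :> R by [].
  apply: le_trans IH; rewrite -!natr1.
  by apply: (@le_trans _ _ ((s n).2 / 2 * (n%:R + 1 + 1))); [rewrite ler_wpM2r//; lra|nra].
have small e : 0 < e -> exists N, (s N).2 < e.
  move=> e0; exists (Num.bound (r / e)).
  have := archi_boundP (ltW (divr_gt0 r0 e0)); set N := Num.bound _ => rN.
  have := sr N; rewrite -natr1; have [_ pos] := gs N.
  by rewrite ltr_pdivrMr// in rN; nra.
have [e e0|z Hz] := pc (fun n => (s n).1).
  have [N sN] := small e e0; exists N => n Nn.
  rewrite -(subnKC Nn); apply: le_lt_trans (sle _ _) _.
  by have [_] := gs (N + (n - N))%N; lra.
have zs n : p (z - (s n).1) <= (s n).2.
  apply/ler_addgt0Pr => e e0; have [N HN] := Hz e e0.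
  apply: le_trans (seminorm_dist _ (s (n + N)%N).1 _ sp) _.
  have := HN (n + N)%N (leq_addl _ _); have := sle n N; have [_] := gs (n + N)%N; lra.
exists z; first by move=> n _; have [_ _ _] := ns n; apply; exact: zs.
have [_ le2 lt2 _] := ns 0%N.
apply: le_lt_trans (seminorm_dist _ (s 1%N).1 _ sp) _.
by have := zs 1%N; rewrite /= in le2 lt2 *; lra.
Qed.

End baire.

(** * Finite seminorms, embeddings and coordinates of the product *)

Section product.
Context {R : realType} {A : eqType} (E : A -> completeNormedModType R).
Let Y := prod_topology E.
Implicit Types (F G : seq A) (x y z h : Y) (a b : A) (e r : R).

Definition psum F y := \sum_(a <- F) `|y a|.

Definition inj a (u : E a) : Y := @dfwith A E (0 : Y) a u.

Definition restrict F h : Y := fun a => if a \in F then h a else 0.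

Lemma inj_linear a : linear (@inj a).
Proof.
move=> k u v; apply: functional_extensionality_dep => b.
rewrite -[RHS]/(k *: inj u b + inj v b) /inj.
have [<-|ab] := eqVneq a b; first by rewrite !dfwithin.
by rewrite !dfwithout// scaler0 addr0.
Qed.

HB.instance Definition _ a := GRing.isLinear.Build R (E a) Y *:%R (@inj a) (@inj_linear a).

Lemma inj_continuous a : continuous (@inj a).
Proof. exact: (@dfwith_continuous A E (0 : Y) a). Qed.

Lemma coord_continuous a : continuous (fun y : Y => y a).
Proof. exact: (@proj_continuous A E a). Qed.

Lemma inj_in a (u : E a) : inj u a = u.
Proof. exact: dfwithin. Qed.

Lemma inj_out a b (u : E a) : a != b -> inj u b = 0.
Proof. exact: dfwithout. Qed.

Lemma psum_seminorm F : seminorm (psum F).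
Proof.
split=> [x y|k x]; rewrite /psum.
  by rewrite -big_split/=; apply: ler_sum => a _; exact: ler_normD.
by rewrite mulr_sumr; apply: eq_bigr => a _; rewrite -normrZ.
Qed.

Lemma coord_le_psum F y a : a \in F -> `|y a| <= psum F y.
Proof.
elim: F => // b F IH; rewrite inE /psum big_cons => /predU1P[->|/IH aF].
  by rewrite lerDl sumr_ge0.
by apply: le_trans aF _; rewrite lerDr.
Qed.

(** The index [a] may occur up to [size F] times in the list; the successor keeps the constant
    positive when [F] is empty. *)
Lemma psum_inj F a (u : E a) : psum F (inj u) <= (size F).+1%:R * `|u|.
Proof.
apply: (@le_trans _ _ ((size F)%:R * `|u|)); last by rewrite ler_wpM2r// ler_nat.
rewrite /psum -sum1_size natr_sum mulr_suml; apply: ler_sum => b _; rewrite mul1r.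
by have [<-|ab] := eqVneq a b; [rewrite inj_in|rewrite inj_out// normr0].
Qed.

Lemma psum_continuous F : continuous_seminorm (psum F).
Proof.
split; first exact: psum_seminorm.
elim: F => [|a F IH] e e0.
  by apply: filterE => y; rewrite /psum/= big_nil.
have e2 : 0 < e / 2 by rewrite divr_gt0.
have nu : nbhs (0 : E a) [set u | `|u| < e / 2].
  by apply/nbhs_normP; exists (e / 2) => // u /=; rewrite sub0r normrN.
have na : nbhs (0 : Y) [set y | `|y a| < e / 2] := @coord_continuous a 0 _ nu.
have FY : Filter (nbhs (0 : Y)) by exact: nbhs_filter.
apply: filterS (filterI na (IH _ e2)) => y /= [ya yF].
by rewrite /psum big_cons (splitr e) ltrD.
Qed.

Lemma nbhs_psum x (V : set Y) : nbhs x V ->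
  exists F r, 0 < r /\ forall y, psum F (y - x) < r -> V y.
Proof.
(* The balls of all seminorms [psum F] at [x] generate a filter; it suffices that this filter
   converges to [x], which is checked one coordinate at a time. *)
pose B := filter_from [set Fr : seq A * R | 0 < Fr.2]
  (fun Fr => [set y | psum Fr.1 (y - x) < Fr.2]).
have FB : Filter B.
  apply: filter_from_filter; first by exists ([::], 1) => /=.
  move=> [F r] [G s] /= r0 s0; exists (F ++ G, Num.min r s); first by rewrite /= lt_min r0.
  move=> y /=; rewrite /psum big_cat/= lt_min => /andP[yr ys].
  split; first by apply: le_lt_trans yr; rewrite lerDl sumr_ge0.
  by apply: le_lt_trans ys; rewrite lerDr sumr_ge0.
suff : B --> x by move=> /[apply] -[[F r] /= r0 Fr]; exists F, r.
apply/cvg_sup => a W /= [_ [[V' oV' <-] Vx VW]].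
apply: filterS VW _.
have /nbhs_normP[e /= e0 eV] : nbhs (x a) V' by exact: open_nbhs_nbhs.
exists ([:: a], e) => // y /=; rewrite /psum big_seq1 => ye.
by apply: eV => /=; rewrite distrC.
Qed.

Lemma psum_complete F : seminorm_complete (psum F).
Proof.
(* Outside [F] the limit may not exist and [lim] takes a default value, which [psum F] does not
   see. *)
move=> u uc; pose z : Y := fun a => lim (u n a @[n --> \oo]).
have zc a : a \in F -> forall e, 0 < e ->
    exists N, forall n, (N <= n)%N -> `|z a - u n a| < e.
  move=> aF e e0.
  have : cvg (u n a @[n --> \oo]).
    apply/cauchy_cvgP/cauchy_exP => d d0; have [N HN] := uc _ d0.
    exists (u N a), N => // n /= Nn; rewrite -ball_normE /= distrC.
    by apply: le_lt_trans (HN n Nn); exact: (coord_le_psum (u n - u N)).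
  move=> /cvgrPdist_lt/(_ _ e0)[N _ HN]; exists N => n Nn; exact: HN.
exists z; have : {subset F <= F} by [].
elim: {1 3}F => [_|a G IH GF] e e0.
  by exists 0%N => n _; rewrite /psum big_nil.
have e2 : 0 < e / 2 by rewrite divr_gt0.
have [|N HN] := IH _ _ e2; first by move=> b bG; apply: GF; rewrite inE bG orbT.
have [|N' HN'] := zc a _ _ e2; first by apply: GF; rewrite mem_head.
exists (maxn N N') => n; rewrite geq_max => /andP[Nn N'n].
by rewrite /psum big_cons (splitr e) ltrD//; [exact: HN'|exact: HN].
Qed.

(** An index repeated in the list must not contribute twice, hence the case distinction. *)
Lemma restrict_cons a F h :
  restrict (a :: F) h = restrict F h + inj (if a \in F then 0 else h a).
Proof.
apply: functional_extensionality_dep => b; rewrite -[RHS]/(restrict F h b + _ b) /restrict inE.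
have [->|ba] := eqVneq b a => /=.
  by rewrite inj_in; case: ifP => _; rewrite ?addr0 ?add0r.
by rewrite inj_out 1?eq_sym// addr0.
Qed.

(** A direction [h] splits as [restrict F h], a finite sum of vectors from the factors, and a
    remainder in the kernel of [psum F]; [eps_smoothD] adds up the pieces. *)
Lemma eps_smooth_coords F (D : set Y) (f : Y -> R^o) x :
  convex_fun_on D f -> bounded_near (psum F) D f x ->
  (forall a, a \in F -> forall e, 0 < e ->
     eps_smooth D f [set inj u | u in [set u : E a | `|u| <= 1]] e x) ->
  forall e, 0 < e -> eps_smooth D f [set h | psum F h <= 1] e x.
Proof.
move=> cf bx sx.
have sp := psum_seminorm F.
have [r [L [r0 L0 lip]]] := bounded_near_lipschitz sp cf bx.
have Dx : D x by case: (lip x x 1) => //; rewrite subrr seminorm0.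
have smoothR G : {subset G <= F} -> forall e, 0 < e ->
    eps_smooth D f [set restrict G h | h in [set h | psum F h <= 1]] e x.
  elim: G => [_|a G IH GF] e e0.
    exists 1, 0; split=> // _ [h _ <-].
    have -> : restrict [::] h = 0 by apply: functional_extensionality_dep => b.
    by rewrite !scaler0 !addr0; split=> //; lra.
  have GF' : {subset G <= F} by move=> b bG; apply: GF; rewrite inE bG orbT.
  have aF : a \in F by apply: GF; rewrite mem_head.
  have [d [c [d0 ce Hd]]] := eps_smoothD cf Dx (IH GF') (sx a aF) e0.
  exists d, c; split=> // _ [h h1 <-]; apply: Hd.
  exists (restrict G h, inj (if a \in G then 0 else h a)); last by rewrite /= restrict_cons.
  split; first by exists h.
  exists (if a \in G then 0 else h a) => //=.
  case: ifP => _; first by rewrite normr0.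
  exact: le_trans (coord_le_psum _ aF) h1.
(* Along the kernel the Lipschitz estimate holds with any positive [d]; [e / (4 * L)] makes each of
   the two increments at most [e / 4]. *)
have smoothK e : 0 < e -> eps_smooth D f [set h | psum F h = 0] e x.
  move=> e0; exists 1, (e / 2); split=> //; first by rewrite ltr_pdivrMr// ltr_pMr// ltr1n.
  move=> h /= h0.
  have near t : D (x + t *: h) /\ f (x + t *: h) - f x <= e / 4.
    have p0 : psum F (x + t *: h - x) = 0.
      by rewrite [x + _]addrC addrK sp.2 h0 mulr0.
    have q0 : 0 < e / (4 * L) by rewrite divr_gt0// mulr_gt0.
    have xx : psum F (x - x) = 0 by rewrite subrr seminorm0.
    have [|||? _ ?] := lip (x + t *: h) x _ q0; rewrite ?p0 ?xx ?(ltW q0)//.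
    split=> //; have <- : L * (e / (4 * L)) = e / 4 by field; rewrite gt_eqF.
    by [].
  have [Dp fp] := near 1; have [Dm fm] := near (- 1); split=> //; lra.
move=> e e0.
have [d [c [d0 ce Hd]]] := eps_smoothD cf Dx (smoothR F (fun _ => id)) smoothK e0.
exists d, c; split=> // h h1; apply: Hd; exists (restrict F h, h - restrict F h).
  split; first by exists h.
  rewrite /= /psum big_seq big1// => a aF.
  by rewrite -[(h - restrict F h) a]/(h a - restrict F h a) /restrict aF subrr normr0.
by rewrite /= subrKC.
Qed.

End product.

(** * Slices and retracts of Asplund spaces *)

Section asplund_lemmas.
Context {R : realType}.

Lemma convex_fun_on_convex (X : tvsType R) (D : set X) (f : X -> R^o) :
  convex_fun_on D f -> convex_set D /\ convex_function D f.
Proof.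
move=> cf; split=> [x y t|t x y]; rewrite !inE => Dx Dy.
  by apply: (cf x y t%:num Dx Dy _).1; rewrite ge0 le1.
by apply: (cf x y t%:num Dx Dy _).2; rewrite ge0 le1.
Qed.

Lemma convex_fun_on_comp (V X : lmodType R) (T : {linear V -> X}) (D : set X)
    (f : X -> R) (x : X) :
  convex_fun_on D f ->
  convex_fun_on [set u | D (x + T u)] (fun u => f (x + T u)).
Proof.
move=> cf u v s /= Du Dv s01; have := cf _ _ _ Du Dv s01.
by rewrite combo_shift linearD !linearZ.
Qed.

Lemma norm_continuous_seminorm (V : normedModType R) :
  continuous_seminorm (fun u : V => `|u|).
Proof.
split; first by split=> [x y|k x]; [exact: ler_normD|rewrite normrZ].
by move=> e e0; apply/nbhs_normP; exists e => // u /=; rewrite sub0r normrN.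
Qed.

Lemma tvs_bounded_unit_ball (V : normedModType R) :
  tvs_bounded [set u : V | `|u| <= 1].
Proof.
move=> U /nbhs_normP[d /= d0 dU]; exists (2 / d); first by rewrite divr_gt0.
move=> t td u /= u1.
have t0 : 0 < `|t| by apply: lt_le_trans td; rewrite divr_gt0.
have tn0 : t != 0 by rewrite -normr_gt0.
exists (t^-1 *: u); last by rewrite scalerA divff// scale1r.
apply: dU; rewrite /= sub0r normrN normrZ normfV mulrC ltr_pdivrMr//.
apply: le_lt_trans u1 _; move: td; rewrite ler_pdivrMr// mulrC; lra.
Qed.

Lemma tvs_bounded_image (V X : tvsType R) (T : {linear V -> X}) (B : set V) :
  continuous T -> tvs_bounded B -> tvs_bounded [set T u | u in B].
Proof.
move=> cT bB U nU.
have nTU : nbhs (0 : V) (T @^-1` U) by apply: cT; rewrite linear0.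
have [r r0 rB] := bB _ nTU; exists r => // t tr _ [u Bu <-].
have [v Uv <-] := rB t tr u Bu.
by exists (T v) => //; rewrite linearZ.
Qed.

(** The function [u |-> f (x + T u)] is convex and continuous on an open set containing 0, so the
    Asplund property of [V] gives it points of differentiability arbitrarily near 0. *)
Lemma eps_smooth_dense_slice (V : normedModType R) (X : tvsType R)
    (T : {linear V -> X}) (D : set X) (f : X -> R^o) (x : X) (r e : R) :
  continuous T -> asplund V -> open D -> convex_fun_on D f ->
  {within D, continuous f} -> D x -> 0 < r -> 0 < e ->
  exists u : V, [/\ `|u| < r, D (x + T u) &
    eps_smooth D f [set T u | u in [set u | `|u| <= 1]] e (x + T u)].
Proof.
move=> cT [_ aV] oD cf; rewrite continuous_open_subspace// => ctf Dx r0 e0.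
pose D' := [set u | D (x + T u)]; pose g u : R^o := f (x + T u).
have cxT : continuous (fun u => x + T u).
  move=> u; have h2 : (fun=> x) @ u --> x by exact: cvg_cst.
  exact: (cvg_comp _ _ (cvg_pair h2 (cT u)) (@add_continuous X (x, T u))).
have oD' : open D' by apply: open_comp oD => u _; exact: cxT.
have D'0 : D' 0 by rewrite /D'/= linear0 addr0.
have [cD' cg] := @convex_fun_on_convex V D' g (convex_fun_on_comp cf).
have ctg : {within D', continuous g}.
  rewrite continuous_open_subspace// => u; rewrite inE => D'u.
  by apply: (cvg_comp _ _ (cxT u)); apply: ctf; rewrite inE.
have [G [GD _ Gd Gf]] := aV D' g (ex_intro _ _ D'0) oD' cD' ctg cg.
have [|u [Gu ur]] := Gd _ D'0 [set u | `|u| < r].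
  by have := (norm_continuous_seminorm V).2 _ r0.
exists u; split=> //; first exact: GD.
have [d [c [d0 ce Hd]]] :=
  frechet_eps_smooth (@tvs_bounded_unit_ball V) (Gf _ Gu) e0.
exists d, c; split=> // _ [h h1 <-]; move: (Hd _ h1).
by rewrite /D' /g /= !linearD !linearZ/= !addrA.
Qed.

Lemma continuous_bounded_near (V : normedModType R) (D : set V) (f : V -> R^o) x :
  open D -> {within D, continuous f} -> D x ->
  bounded_near (fun u : V => `|u|) D f x.
Proof.
move=> oD; rewrite continuous_open_subspace// => ctf Dx.
have nf : nbhs x [set y | f y < f x + 1].
  have /cvgrPdist_lt/(_ _ ltr01) : f @ x --> f x by apply: ctf; rewrite inE.
  by apply: filterS => y /=; rewrite ltr_norml; lra.
have nD : nbhs x D by exact: open_nbhs_nbhs.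
have nDf : nbhs x (D `&` [set y | f y < f x + 1]) by exact: filterI.
move: nDf => /nbhs_normP[r /= r0 rD].
exists r, (f x + 1); split=> // y yr.
by have [|? /ltW] := rD y; rewrite /= 1?distrC.
Qed.

Lemma invn_small e : 0 < e -> exists n, (n.+1%:R^-1 : R) < e.
Proof.
move=> e0; exists (Num.bound e^-1); rewrite invf_plt ?posrE//.
apply: lt_trans (archi_boundP _) _; first by rewrite invr_ge0 ltW.
by rewrite ltr_nat.
Qed.

(** Where [f \o P] is differentiable at [y], it is smooth along the image under [T] of the unit
    ball; since [P] inverts [T], this is smoothness of [f] at [P y]. *)
Lemma asplund_retract (V : normedModType R) (X : tvsType R)
    (P : {linear X -> V}) (T : {linear V -> X}) :
  continuous P -> continuous T -> cancel T P -> asplund X -> asplund V.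
Proof.
move=> cP cT TP [_ aX]; split; first exact: norm_hausdorff.
move=> D f [u0 Du0] oD cD ctf cf'; have cf := convex_fun_onP cD cf'.
pose D' := P @^-1` D; pose g : X -> R^o := f \o P.
have oD' : open D' by apply: open_comp oD => y _; exact: cP.
have D'0 : D' (T u0) by rewrite /D'/= TP.
have [cD' cg] : convex_set D' /\ convex_function D' g.
  apply: convex_fun_on_convex => x y s D'x D'y s01.
  by have := cf _ _ _ D'x D'y s01; rewrite /D'/g/= linearD !linearZ.
have ctg : {within D', continuous g}.
  move: ctf; rewrite !continuous_open_subspace// => ctf y; rewrite inE => D'y.
  by apply: (cvg_comp _ _ (cP y)); apply: ctf; rewrite inE.
have [G' [G'D' _ G'd G'f]] := aX D' g (ex_intro _ _ D'0) oD' cD' ctg cg.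
pose B := [set h : V | `|h| <= 1].
(* The image under [P] of [G'] need not be G_delta; it serves for density, while the G_delta set is
   the intersection of the open sets [W n]. *)
pose W n := [set x | D x /\ eps_smooth D f B n.+1%:R^-1 x].
have bnear x : D x -> bounded_near (fun u : V => `|u|) D f x.
  exact: continuous_bounded_near.
have [sV nV] := norm_continuous_seminorm V.
exists (\bigcap_n W n); split.
- by move=> x /(_ 0%N I)[].
- exists W => // n; rewrite openE => x [Dx sx].
  have [//|r r0 Hr] := eps_smooth_open sV cf (bnear x Dx) ltr01 _ sx.
  by apply: filterS (seminorm_ball_nbhs x (conj sV nV) r0) => y /Hr.
- move=> x Dx U nU.
  have [||y [G'y Uy]] := G'd (T x) _ (P @^-1` U).
  + by rewrite /D'/= TP.
  + by apply: cP; rewrite TP.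
  exists (P y); split=> // n _; split; first exact: G'D'.
  have n0 : 0 < n.+1%:R^-1 :> R by rewrite invr_gt0.
  have [d [c [d0 ce Hd]]] := frechet_eps_smooth
    (tvs_bounded_image cT (@tvs_bounded_unit_ball V)) (G'f y G'y) n0.
  exists d, c; split=> // h h1; move: (Hd (T h)).
  rewrite /D' /g /= !linearD !linearZ/= TP.
  by apply; exists h.
- move=> x Gx; have [Dx _] := Gx 0%N I.
  apply: (eps_smooth_frechet oD cf Dx (conj sV nV) (bnear x Dx)) => e e0.
  by have [n ne] := invn_small e0; apply: eps_smooth_le (ltW ne) (Gx n I).2.
Qed.

End asplund_lemmas.

(** * Asplund products and their factors *)

Lemma asplund_product (R : realType) (A : eqType) (E : A -> completeNormedModType R) :
  (forall a, asplund (E a)) -> asplund (prod_topology E).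
Proof.
move=> aE; pose Y := prod_topology E.
split; first by apply: hausdorff_product => a; exact: norm_hausdorff.
move=> D f [y0 Dy0] oD cD ctf cf'; have cf := convex_fun_onP cD cf'.
(* A single finite list serves all of [D]: boundedness for [psum F] near [y0] spreads to every
   point. *)
have [F bF] : exists F, bounded_near (@psum R A E F) D f y0.
  have nf : nbhs y0 [set y | f y < f y0 + 1].
    have : {for y0, continuous f}.
      by move: ctf; rewrite continuous_open_subspace//; apply; rewrite inE.
    move=> /cvgrPdist_lt/(_ _ ltr01).
    by apply: filterS => y /=; rewrite ltr_norml; lra.
  have nD : nbhs y0 D by exact: open_nbhs_nbhs.
  have [F [r [r0 Fr]]] := nbhs_psum (filterI nD nf).
  by exists F, r, (f y0 + 1); split=> // y /Fr[Dy /ltW].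
have sF := @psum_seminorm R A E F.
have bnear x : D x -> bounded_near (psum F) D f x.
  move=> Dx; apply: bounded_near_spread sF cf _ bF => v.
  have [d d0 dD] := open_absorbing v oD Dx.
  by exists d => //; apply: dD; rewrite gtr0_norm.
pose B a := [set inj u | u in [set u : E a | `|u| <= 1]].
(* The list [G] varies for the inductions on openness and density, while the seminorm keeps [F]. *)
pose W (G : seq A) n := [set x | D x /\
  forall a, a \in G -> eps_smooth D f (B a) n.+1%:R^-1 x].
have K0 : 0 < (size F).+1%:R :> R by [].
have Wo G n x : W G n x -> exists2 r, 0 < r & forall y, psum F (y - x) < r -> W G n y.
  elim: G => [|a G IH] [Dx sx].
    by have [r [M [r0 xr]]] := bnear x Dx; exists r => // y /xr[].
  have [|r r0 Gr] := IH; first by split=> // b bG; apply: sx; rewrite inE bG orbT.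
  have [|s s0 Hs] := eps_smooth_open sF cf (bnear x Dx) K0 _ (sx a (mem_head _ _)).
    move=> _ [u u1 <-]; apply: le_trans (psum_inj _ _) _.
    by rewrite ler_piMr.
  exists (Num.min r s); first by rewrite lt_min r0.
  move=> y; rewrite lt_min => /andP[yr ys]; have [Dy sy] := Hs _ ys.
  by split=> // b; rewrite inE => /predU1P[->//|]; exact: (Gr _ yr).2.
have Wd G n x r : D x -> 0 < r -> exists2 y, W G n y & psum F (y - x) < r.
  move=> Dx r0; elim: G => [|a G [y Wy yx]].
    by exists x => //; rewrite subrr seminorm0.
  have [s s0 Hs] := Wo _ _ _ Wy.
  (* Moving [y] along the factor [a] must neither leave the open set [W G n] nor the ball of radius
     [r] at [x]; the divisor is the constant of [psum_inj]. *)
  pose t := Num.min s (r - psum F (y - x)) / (size F).+1%:R.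
  have t0 : 0 < t by rewrite divr_gt0// lt_min s0 subr_gt0.
  have n0 : 0 < n.+1%:R^-1 :> R by rewrite invr_gt0.
  have [u [ut Du su]] := eps_smooth_dense_slice (T := @inj R A E a)
    (@inj_continuous R A E a) (aE a) oD cf ctf Wy.1 t0 n0.
  have : psum F (inj u) < Num.min s (r - psum F (y - x)).
    by apply: le_lt_trans (psum_inj _ _) _; rewrite mulrC -ltr_pdivlMr.
  rewrite lt_min => /andP[us ur]; exists (y + inj u).
    split=> // b; rewrite inE => /predU1P[->//|].
    by apply: (Hs _ _).2; rewrite [y + _]addrC addrK.
  by rewrite addrAC; apply: le_lt_trans (sF.1 _ _) _; lra.
exists (\bigcap_n W F n); split.
- by move=> x /(_ 0%N I)[].
- exists (W F) => // n; rewrite openE => x /Wo[r r0 Hr].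
  by apply: filterS (seminorm_ball_nbhs x (@psum_continuous R A E F) r0) => y /Hr.
- move=> x Dx U /nbhs_psum[G [r [r0 Gr]]].
  have KG : 0 < (size G).+1%:R :> R by [].
  have [|y Wy yx] := baire_seminorm sF (@psum_complete R A E F) _ (Wo F) (Wd F) Dx
    (divr_gt0 r0 KG).
    by move=> n z [].
  (* Closeness for [psum F] is not closeness in the product, so [z] takes the coordinates of [y] on
     [F] and those of [x] elsewhere. It has [psum F] distance 0 from [y], hence stays in each open
     [W F n], and differs from [x] only on [F], hence is near [x] for [psum G]. *)
  pose z : Y := x + restrict F (y - x).
  have zy : psum F (z - y) = 0.
    rewrite /psum big_seq big1// => a aF.
    rewrite -[(z - y) a]/(x a + restrict F (y - x) a - y a) /restrict aF.
    by rewrite -[(y - x) a]/(y a - x a) subrKC subrr normr0.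
  exists z; split.
    by move=> n _; have [s s0] := Wo F n y (Wy n I); apply; rewrite zy.
  apply: Gr; rewrite /z [x + _]addrC addrK.
  apply: (@le_lt_trans _ _ ((size G).+1%:R * psum F (y - x))); last first.
    by rewrite mulrC -ltr_pdivlMr.
  apply: (@le_trans _ _ ((size G)%:R * psum F (y - x))); last first.
    by rewrite ler_wpM2r ?ler_nat// seminorm_ge0.
  rewrite /(psum G) -sum1_size natr_sum mulr_suml; apply: ler_sum => a _; rewrite mul1r.
  rewrite /restrict; case: ifP => aF; last by rewrite normr0 seminorm_ge0.
  exact: coord_le_psum.
- move=> x Gx; have [Dx _] := Gx 0%N I.
  apply: (eps_smooth_frechet oD cf Dx (@psum_continuous R A E F) (bnear x Dx)).
  apply: (eps_smooth_coords cf (bnear x Dx)) => a aF e e0.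
  by have [n ne] := invn_small e0; apply: eps_smooth_le (ltW ne) ((Gx n I).2 a aF).
Qed.

Lemma asplund_factor (R : realType) (A : eqType) (E : A -> completeNormedModType R) a :
  asplund (prod_topology E) -> asplund (E a).
Proof.
have lP : linear (fun y : prod_topology E => y a : E a) by [].
pose P : {linear prod_topology E -> E a} := HB.pack (fun y : prod_topology E => y a : E a)
  (GRing.isLinear.Build R (prod_topology E) (E a) *:%R _ lP).
apply: (@asplund_retract R (E a) (prod_topology E) P (@inj R A E a)).
- exact: (@coord_continuous R A E a).
- exact: (@inj_continuous R A E a).
- exact: (@inj_in R A E a).
Qed.

Theorem theorem2p3 (R : realType) (A : Type) (E : A -> completeNormedModType R) :
  asplund (prod_topology E) <-> forall a : A, asplund (E a).
Proof.
(* Membership in lists of indices needs a decidable equality on [A], obtained classically from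
   [classicType]. *)
split=> [aY a|aE]; first exact: (@asplund_factor R (classicType A) E a aY).
exact: (@asplund_product R (classicType A) E aE).
Qed.
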